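(* Let $\sigma:\mathbb{R}\to\mathbb{R}$ be a smooth ReLU-like function, let $\mathbf{W}_{up},\mathbf{W}_{gate}\in\mathbb{R}^{D\times d}$, $\mathbf{W}_{down}\in\mathbb{R}^{d\times D}$, let $\mathsf{FG}(\mathbf{x})=\mathbf{W}_{down}\big(\sigma^*(\mathbf{W}_{gate}\mathbf{x})\odot\mathbf{W}_{up}\mathbf{x}\big)$ (with $\sigma^*$ the entrywise application of $\sigma$), and let $\mathbf{x}\in\mathbb{R}^d$. For every $\epsilon>0$ (with $\tau_\epsilon$ from the definition of a ReLU-like function) and every triplet $1\le p,q,r\le\infty$, writing $S'=\|\sigma'\|_{C([-\tau_\epsilon,\tau_\epsilon])}$ and $S=\|\sigma\|_{C([-\tau_\epsilon,\tau_\epsilon])}$, the normwise condition numbers of $\mathsf{FG}$ are bounded by $$\kappa_{p,q}(\mathsf{FG},\mathbf{x})\le\Big(\epsilon(\nu_-+\tilde\nu_-)+S'\nu_0+S\tilde\nu_0+(1+\epsilon)\big(\nu_++\|\mathbf{W}_{gate}^{(+)}\mathbf{x}\|_\infty\tilde\nu_+\big)\Big)\frac{\|\mathbf{x}\|_p}{\|\mathsf{FG}(\mathbf{x})\|_q},$$ where $$\nu_\theta=\|\mathbf{W}_{down}^{(\theta)}\|_{r,q}\|\mathrm{diag}(\mathbf{W}_{up}^{(\theta)}\mathbf{x})\mathbf{W}_{gate}^{(\theta)}\|_{p,r},\qquad\tilde\nu_\theta=\|\mathbf{W}_{down}^{(\theta)}\|_{r,q}\|\mathbf{W}_{up}^{(\theta)}\|_{p,r}$$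 are defined for $\theta\in\{-,0,+\}$ based on $\mathbf{y}=\mathbf{W}_{gate}\mathbf{x}$ as $$\mathbf{W}_{down}^{(\theta)}=\mathbf{W}_{down}(:,\Omega_\theta),\quad\mathbf{W}_{up}^{(\theta)}=\mathbf{W}_{up}(\Omega_\theta,:),\quad\mathbf{W}_{gate}^{(\theta)}=\mathbf{W}_{gate}(\Omega_\theta,:),$$ $$\Omega_-=\{i:y_i<-\tau_\epsilon\},\quad\Omega_0=\{i:|y_i|\le\tau_\epsilon\},\quad\Omega_+=\{i:y_i>\tau_\epsilon\}.$$ Its mixed condition numbers are bounded by $$\kappa_{c,q}(\mathsf{FG},\mathbf{x})\le\Big(\epsilon(\xi_-+\tilde\xi_-)+S'\xi_0+S\tilde\xi_0+(1+\epsilon)\big(\xi_++\|\mathbf{W}_{gate}^{(+)}\mathbf{x}\|_\infty\tilde\xi_+\big)\Big)\frac{1}{\|\mathsf{FG}(\mathbf{x})\|_q},$$ $$\kappa_{p,c}(\mathsf{FG},\mathbf{x})\le\Big(\epsilon(\eta_-+\tilde\eta_-)+S'\eta_0+S\tilde\eta_0+(1+\epsilon)\big(\eta_++\|\mathbf{W}_{gate}^{(+)}\mathbf{x}\|_\infty\tilde\eta_+\big)\Big)\|\mathbf{x}\|_p,$$ where $$\xi_\theta=\|\mathbf{W}_{down}^{(\theta)}\|_{r,q}\|\mathrm{diag}(\mathbf{W}_{up}^{(\theta)}\mathbf{x})\mathbf{W}_{gate}^{(\theta)}\mathrm{diag}(\mathbf{x})\|_{\infty,r},\qquad\tilde\xi_\theta=\|\mathbf{W}_{down}^{(\theta)}\|_{r,q}\|\mathbf{W}_{up}^{(\theta)}\mathrm{diag}(\mathbf{x})\|_{\infty,r},$$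 $$\eta_\theta=\|\mathrm{diag}(\mathsf{FG}(\mathbf{x}))^{-1}\mathbf{W}_{down}^{(\theta)}\|_{r,\infty}\|\mathrm{diag}(\mathbf{W}_{up}^{(\theta)}\mathbf{x})\mathbf{W}_{gate}^{(\theta)}\|_{p,r},\qquad\tilde\eta_\theta=\|\mathrm{diag}(\mathsf{FG}(\mathbf{x}))^{-1}\mathbf{W}_{down}^{(\theta)}\|_{r,\infty}\|\mathbf{W}_{up}^{(\theta)}\|_{p,r}.$$ The componentwise condition number is bounded by $$\kappa_{c,c}(\mathsf{FG},\mathbf{x})\le\epsilon(\chi_-+\tilde\chi_-)+S'\chi_0+S\tilde\chi_0+(1+\epsilon)\big(\chi_++\|\mathbf{W}_{gate}^{(+)}\mathbf{x}\|_\infty\tilde\chi_+\big),$$ where $$\chi_\theta=\|\mathrm{diag}(\mathsf{FG}(\mathbf{x}))^{-1}\mathbf{W}_{down}^{(\theta)}\|_{r,\infty}\|\mathrm{diag}(\mathbf{W}_{up}^{(\theta)}\mathbf{x})\mathbf{W}_{gate}^{(\theta)}\mathrm{diag}(\mathbf{x})\|_{\infty,r},$$ $$\tilde\chi_\theta=\|\mathrm{diag}(\mathsf{FG}(\mathbf{x}))^{-1}\mathbf{W}_{down}^{(\theta)}\|_{r,\infty}\|\mathbf{W}_{up}^{(\theta)}\mathrm{diag}(\mathbf{x})\|_{\infty,r}.$$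
   Context: $\odot$ is the entrywise product. A smooth function $\sigma:\mathbb{R}\to\mathbb{R}$ is ReLU-like if for every $\epsilon>0$ there is $\tau_\epsilon>0$ such that $\max\{|\sigma(x)|,|\sigma'(x)|\}<\epsilon$ for $x<-\tau_\epsilon$ and $\max\{|\sigma(x)/x-1|,|\sigma'(x)-1|\}<\epsilon$ for $x>\tau_\epsilon$. $\|h\|_{C(I)}=\sup_{x\in I}|h(x)|$. $\|\cdot\|_{p,q}$ is the $\ell_p\to\ell_q$ operator norm of a matrix; $\mathbf W(:,\Omega)$ and $\mathbf W(\Omega,:)$ are the submatrices of columns, resp. rows, indexed by $\Omega$ (a term with empty $\Omega_\theta$ is zero). Condition numbers: for vectors $\hat{\mathbf w},\mathbf w$ put $\rho_p(\hat{\mathbf w},\mathbf w)=\|\hat{\mathbf w}-\mathbf w\|_p/\|\mathbf w\|_p$ and $\rho_c(\hat{\mathbf w},\mathbf w)=\max_i|(\hat w_i-w_i)/w_i|$, with the conventions $a/0=\infty$ for $a\ne0$ and $0/0=0$. For a function $f$, a point $\mathbf v$, and $\theta_{in},\theta_{out}\in[1,\infty]\cup\{c\}$, $$\kappa_{\theta_{in},\theta_{out}}(f,\mathbf v)=\lim_{t\to0}\sup\Big\{\frac{\rho_{\theta_{out}}(f(\hat{\mathbf v}),f(\mathbf v))}{\rho_{\theta_{in}}(\hat{\mathbf v},\mathbf v)}:\rho_{\theta_{in}}(\hat{\mathbf v},\mathbf v)\le t\Big\}$$ ($\hat{\mathbf v}=\mathbf v$ is allowed; the value may be infinite).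
   Formalization: Where a right-hand side would read 0·∞, undefined in the text, the product counts as ∞ for S' or S times an infinite term and for the bracket times an infinite ‖x‖_p/‖FG(x)‖_q or 1/‖FG(x)‖_q; other products 0·∞ count as 0. With 0·∞=0 throughout, the bounds can fail when FG(x)=0. *)

(* Defs.v *)
From HB Require Import structures.
From mathcomp Require Import all_boot all_order all_algebra.
From mathcomp Require Import all_classical all_reals all_analysis.

Set Implicit Arguments.
Unset Strict Implicit.
Unset Printing Implicit Defensive.

Import Order.TTheory GRing.Theory Num.Theory.
Import numFieldNormedType.Exports.

Local Open Scope classical_set_scope.
Local Open Scope ring_scope.

Section Activation.
Variable R : realType.
Implicit Types (sigma : R -> R) (eps tau : R).

Definition smooth sigma : Prop :=
  forall (n : nat) (x : R), derivable (sigma^`(n)%classic) x 1.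

Definition relu_threshold sigma eps tau : Prop :=
  [/\ 0 < tau,
      forall x, x < - tau ->
        Num.max `|sigma x| `|sigma^`()%classic x| < eps
    & forall x, tau < x ->
        Num.max `|sigma x / x - 1| `|sigma^`()%classic x - 1| < eps].

Definition relu_like sigma : Prop :=
  forall eps, 0 < eps -> exists tau, relu_threshold sigma eps tau.

Definition sup_norm (h : R -> R) (I : set R) : \bar R :=
  ereal_sup [set `|h x|%:E | x in I].

End Activation.

Section Norms.
Variable R : realType.

(* Only meant for 1 <= p <= +oo; the value at -oo is a dummy. *)
Definition lp_norm (p : \bar R) n (v : 'cV[R]_n) : R :=
  match p with
  | s%:E => (\sum_i `|v i 0| `^ s) `^ s^-1
  | +oo%E => \big[Num.max/0]_i `|v i 0|
  | -oo%E => 0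
  end.

Definition op_norm (p q : \bar R) m n (A : 'M[R]_(m, n)) : \bar R :=
  ereal_sup [set (lp_norm q (A *m z))%:E | z in [set z | lp_norm p z <= 1]].

Definition diagc n (v : 'cV[R]_n) : 'M[R]_n := diag_mx v^T.

(* || diag(c)^-1 A ||_{p,q}, where the entries A i j / c i of the matrix follow
   the conventions a / 0 = +oo for a != 0, and 0 / 0 = 0 (the latter is built
   in, as 0^-1 = 0 in R). *)
Definition op_norm_idiag (p q : \bar R) m n (c : 'cV[R]_m) (A : 'M[R]_(m, n)) :
    \bar R :=
  if [exists i, (c i 0 == 0) && (row i A != 0)] then +oo%E
  else op_norm p q (diagc (map_mx GRing.inv c) *m A).

End Norms.

Section Conditioning.
Variable R : realType.

Inductive metric : Type := Normwise of \bar R | Componentwise.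

(* Division in \bar R satisfies a / 0 = +oo for a > 0, and 0 / 0 = 0. *)
Definition rel_dist (th : metric) n (w' w : 'cV[R]_n) : \bar R :=
  match th with
  | Normwise p => ((lp_norm p (w' - w))%:E / (lp_norm p w)%:E)%E
  | Componentwise =>
      \big[maxe/0%E]_i (`|w' i 0 - w i 0|%:E / `|w i 0|%:E)%E
  end.

Definition cond_number (th_in th_out : metric) n m
    (f : 'cV[R]_n -> 'cV[R]_m) (v : 'cV[R]_n) : \bar R :=
  lim (ereal_sup
         [set (rel_dist th_out (f v') (f v) / rel_dist th_in v' v)%E
         | v' in [set v' | (rel_dist th_in v' v <= t%:E)%E]]
       @[t --> 0^'+]).

End Conditioning.

Arguments Componentwise {R}.

Section GatedFeedForward.
Variables (R : realType) (d D : nat) (sigma : R -> R).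
Variables (Wup Wgate : 'M[R]_(D, d)) (Wdown : 'M[R]_(d, D)).

Definition FG (x : 'cV[R]_d) : 'cV[R]_d :=
  Wdown *m map2_mx *%R (map_mx sigma (Wgate *m x)) (Wup *m x).

Variables (x : 'cV[R]_d) (tau : R).

Inductive region := Neg | Mid | Pos.

Definition Omega (th : region) : {set 'I_D} :=
  let y := Wgate *m x in
  match th with
  | Neg => [set i | y i 0 < - tau]%SET
  | Mid => [set i | `|y i 0| <= tau]%SET
  | Pos => [set i | tau < y i 0]%SET
  end.

Definition Wdown_at (th : region) : 'M[R]_(d, #|Omega th|) :=
  colsub enum_val Wdown.
Definition Wup_at (th : region) : 'M[R]_(#|Omega th|, d) :=
  rowsub enum_val Wup.
Definition Wgate_at (th : region) : 'M[R]_(#|Omega th|, d) :=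
  rowsub enum_val Wgate.

Variables (p q r : \bar R).

Local Open Scope ereal_scope.

Definition fg_nu th :=
  op_norm r q (Wdown_at th) *
  op_norm p r (diagc (Wup_at th *m x) *m Wgate_at th).
Definition fg_nu_t th := op_norm r q (Wdown_at th) * op_norm p r (Wup_at th).

Definition fg_xi th :=
  op_norm r q (Wdown_at th) *
  op_norm +oo r (diagc (Wup_at th *m x) *m Wgate_at th *m diagc x).
Definition fg_xi_t th :=
  op_norm r q (Wdown_at th) * op_norm +oo r (Wup_at th *m diagc x).

Definition fg_eta th :=
  op_norm_idiag r +oo (FG x) (Wdown_at th) *
  op_norm p r (diagc (Wup_at th *m x) *m Wgate_at th).
Definition fg_eta_t th :=
  op_norm_idiag r +oo (FG x) (Wdown_at th) * op_norm p r (Wup_at th).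

Definition fg_chi th :=
  op_norm_idiag r +oo (FG x) (Wdown_at th) *
  op_norm +oo r (diagc (Wup_at th *m x) *m Wgate_at th *m diagc x).
Definition fg_chi_t th :=
  op_norm_idiag r +oo (FG x) (Wdown_at th) *
  op_norm +oo r (Wup_at th *m diagc x).

(* Product of a >= 0 and b >= 0 with 0 * +oo = +oo, whereas mule has
   0 * +oo = 0. It is used where the value 0 would make the bounds false:
   sigma may vanish on [-tau, tau] but not beyond (this forces eps >= 1), and
   then, if y_i = tau and FG x = 0, S = S' = 0 although FG may be nonzero
   arbitrarily close to x, so that the condition numbers are infinite. *)
Definition mule_ytop (a b : \bar R) : \bar R := if b == +oo then +oo else a * b.

Definition bound_factor (eps : R) (n n_t : region -> \bar R) : \bar R :=
  let S' := sup_norm sigma^`()%classic `[(- tau)%R, tau]%classic in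
  let S := sup_norm sigma `[(- tau)%R, tau]%classic in
  eps%:E * (n Neg + n_t Neg) + mule_ytop S' (n Mid) + mule_ytop S (n_t Mid)
  + (1 + eps)%:E
    * (n Pos + (lp_norm +oo (Wgate_at Pos *m x))%:E * n_t Pos).

End GatedFeedForward.

(* Main.v *)
(* Write FG x = Wdown h(x) for the hidden layer h and x' = x + N z, where N = 1
   in the normwise case and N = diag(x) in the componentwise case, in which z is
   the vector of relative perturbations. To first order, h(x') - h(x) is
     diag(sigma'(y)) diag(Wup x) Wgate N z + diag(sigma(y)) Wup N z.
   Splitting Wdown h into the blocks Neg, Mid, Pos, applying the triangle
   inequality and bounding sigma, sigma' on each block gives the factor of the
   bound; the remainder is o(z) and disappears in the limit. Componentwise output
   errors are the max norm after Wdown has been scaled by diag(FG x)^-1. *)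

Require Import Defs.
From HB Require Import structures.
From mathcomp Require Import all_boot all_order all_algebra.
From mathcomp Require Import all_classical all_reals all_analysis.
From mathcomp Require Import ring lra.

Set Implicit Arguments.
Unset Strict Implicit.
Unset Printing Implicit Defensive.

Import Order.TTheory GRing.Theory Num.Theory.
Import numFieldNormedType.Exports.

Local Open Scope classical_set_scope.
Local Open Scope ring_scope.

#[local] Hint Extern 0 (is_true (1 <= +oo)%E) => exact: leey : core.

(** * [lp_norm] as a norm: monotonicity, homogeneity, coordinate bounds, Minkowski *)

Section LpNorm.
Variable R : realType.
Implicit Types (p q : \bar R) (n : nat).

Lemma exponent_cases p : (1 <= p)%E -> (exists2 s : R, p = s%:E & 1 <= s) \/ p = +oo%E.
Proof.
case: p => [s||] //=; last by right.
by rewrite lee_fin => s1; left; exists s.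
Qed.

Lemma lp_norm_ge0 p n (v : 'cV[R]_n) : 0 <= lp_norm p v.
Proof.
case: p => [s||] //=; first exact: powR_ge0.
by apply: bigmax_ge_id.
Qed.

Lemma ler_lp_norm p n (u v : 'cV[R]_n) : (1 <= p)%E ->
  (forall i, `|u i 0| <= `|v i 0|) -> lp_norm p u <= lp_norm p v.
Proof.
move=> /exponent_cases[[s -> s1]|->] uv /=; last first.
  exact: le_bigmax2.
have s0 : 0 <= s by apply: le_trans s1.
have sum0 (w : 'cV[R]_n) : 0 <= \sum_i `|w i 0| `^ s.
  by apply: sumr_ge0 => i _; exact: powR_ge0.
apply: ge0_ler_powR; rewrite ?nnegrE ?invr_ge0 //.
by apply: ler_sum => i _; apply: ge0_ler_powR; rewrite ?nnegrE.
Qed.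

Lemma lp_normZ p n (a : R) (v : 'cV[R]_n) : (1 <= p)%E ->
  lp_norm p (a *: v) = `|a| * lp_norm p v.
Proof.
move=> /exponent_cases[[s -> s1]|->] /=; last first.
  rewrite (eq_bigr (fun i => `|a| * `|v i 0|)) => [|i _]; last first.
    by rewrite mxE normrM.
  rewrite (big_morph (fun y => `|a| * y) (op1 := Num.max) (id1 := 0)) ?mulr0 //.
  by move=> y z; rewrite maxr_pMr.
have s0 : 0 < s by apply: lt_le_trans s1.
under eq_bigr => i _ do rewrite mxE normrM powRM //.
rewrite -mulr_sumr powRM ?powR_ge0 //; last first.
  by apply: sumr_ge0 => i _; exact: powR_ge0.
by rewrite -powRrM divff ?gt_eqF // powRr1.
Qed.

Lemma lp_norm0 p n : (1 <= p)%E -> lp_norm p (0 : 'cV[R]_n) = 0.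
Proof. by move=> p1; rewrite -(scale0r 0) lp_normZ // normr0 mul0r. Qed.

Lemma lp_norm_coord p n (v : 'cV[R]_n) i : (1 <= p)%E -> `|v i 0| <= lp_norm p v.
Proof.
move=> /exponent_cases[[s -> s1]|->] /=; last first.
  exact: (le_bigmax _ (fun i => `|v i 0|)).
have s0 : 0 < s by apply: lt_le_trans s1.
rewrite -{1}[`|v i 0|]powRr1 // -{1}(@divff _ s) ?gt_eqF // powRrM.
apply: ge0_ler_powR; rewrite ?nnegrE ?powR_ge0 ?invr_ge0 ?(ltW s0) //.
  by apply: sumr_ge0 => j _; exact: powR_ge0.
by rewrite (bigD1 i) //= lerDl sumr_ge0 // => j _; exact: powR_ge0.
Qed.

Lemma lp_norm_le0 p n (v : 'cV[R]_n) : (1 <= p)%E -> lp_norm p v <= 0 -> v = 0.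
Proof.
move=> p1 v0; apply/colP => i; rewrite mxE; apply/eqP.
rewrite -normr_le0; exact: le_trans (lp_norm_coord v i p1) v0.
Qed.

Lemma linf_norm_le n (v : 'cV[R]_n) c : 0 <= c ->
  (forall i, `|v i 0| <= c) -> lp_norm +oo v <= c.
Proof. by move=> c0 vc; apply: bigmax_le => // i _. Qed.

Lemma powR_convex2 (s a x y : R) : 1 <= s -> 0 <= a <= 1 -> 0 <= x -> 0 <= y ->
  (a * x + (1 - a) * y) `^ s <= a * x `^ s + (1 - a) * y `^ s.
Proof.
move=> s1 /andP[a0 a1] x0 y0.
have := @convex_powR R s s1 (Itv01 a0 a1) (x : R^o) (y : R^o).
by apply; rewrite inE /= in_itv /= andbT.
Qed.

Lemma lp_normD p n (u v : 'cV[R]_n) : (1 <= p)%E ->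
  lp_norm p (u + v) <= lp_norm p u + lp_norm p v.
Proof.
move=> p1; have [[s ps s1]|p_oo] := exponent_cases p1; last first.
  rewrite p_oo in p1 *; apply: linf_norm_le => [|i].
    by apply: addr_ge0; exact: lp_norm_ge0.
  by rewrite mxE (le_trans (ler_normD _ _)) // lerD // lp_norm_coord.
(* Zero vectors are treated first, since the normalization below divides by both norms. *)
have [u0|u0] := leP (lp_norm p u) 0.
  by rewrite (lp_norm_le0 p1 u0) add0r lp_norm0 // add0r.
have [v0|v0] := leP (lp_norm p v) 0.
  by rewrite (lp_norm_le0 p1 v0) addr0 lp_norm0 // addr0.
have s0 : 0 < s by apply: lt_le_trans s1.
have sumE (w : 'cV[R]_n) : lp_norm p w = 1 -> \sum_i `|w i 0| `^ s = 1.
  have w0 : 0 <= \sum_i `|w i 0| `^ s by apply: sumr_ge0 => i _; exact: powR_ge0.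
  rewrite ps /= => /(congr1 (fun z => z `^ s)).
  by rewrite -powRrM mulVf ?gt_eqF // powRr1 // powR1.
set A := lp_norm p u in u0 *; set B := lp_norm p v in v0 *.
have AB0 : 0 < A + B by rewrite addr_gt0.
(* The unit ball is convex; normalizing u and v reduces the claim to it. *)
pose u' := A^-1 *: u; pose v' := B^-1 *: v; pose a := A / (A + B).
have a01 : 0 <= a <= 1.
  by rewrite divr_ge0 ?ler_pdivrMr ?mul1r ?lerDl ?ltW.
have u'1 : lp_norm p u' = 1.
  by rewrite lp_normZ // gtr0_norm ?invr_gt0 // mulVf ?gt_eqF.
have v'1 : lp_norm p v' = 1.
  by rewrite lp_normZ // gtr0_norm ?invr_gt0 // mulVf ?gt_eqF.
have uvE : u + v = (A + B) *: (a *: u' + (1 - a) *: v').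
  apply/colP => i; rewrite !mxE /a; field.
  by rewrite !gt_eqF.
move: u' v' a a01 u'1 v'1 uvE => u' v' a a01 u'1 v'1 ->.
rewrite lp_normZ // gtr0_norm // ger_pMr // ps /=.
have e1 : 1 `^ s^-1 = 1 :> R by rewrite powR1.
rewrite -[leRHS]e1; apply: ge0_ler_powR; rewrite ?nnegrE ?invr_ge0 ?(ltW s0) //.
  by apply: sumr_ge0 => i _; exact: powR_ge0.
(* Both unit vectors have power sum 1, so 1 is the convex combination of these sums, and convexity
   of the [s]-th power applies termwise. *)
rewrite [leRHS](_ : _ = a * \sum_i `|u' i 0| `^ s
    + (1 - a) * \sum_i `|v' i 0| `^ s); last first.
  by rewrite !sumE // !mulr1 subrKC.
rewrite !mulr_sumr -big_split /=.
apply: ler_sum => i _; apply: le_trans (powR_convex2 s1 a01 _ _) => //.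
have /andP[a0 a1] := a01.
apply: ge0_ler_powR; rewrite ?nnegrE ?(ltW s0) //.
  by rewrite addr_ge0 // mulr_ge0 // subr_ge0.
rewrite !mxE (le_trans (ler_normD _ _)) // !normrM.
by rewrite [`|a|]ger0_norm // [`|1 - a|]ger0_norm // subr_ge0.
Qed.

Lemma lp_norm_sum p n (I : Type) (s : seq I) (P : pred I) (w : I -> 'cV[R]_n) :
  (1 <= p)%E ->
  lp_norm p (\sum_(i <- s | P i) w i) <= \sum_(i <- s | P i) lp_norm p (w i).
Proof.
move=> p1; elim/big_ind2 : _ => //; first by rewrite lp_norm0.
by move=> u a v b ua vb; rewrite (le_trans (lp_normD _ _ p1)) // lerD.
Qed.

End LpNorm.

(** * Operator norms between [lp] spaces *)

Section OpNorm.
Variable R : realType.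
Implicit Types (p q r : \bar R).

Lemma op_norm_ge0 p q m n (A : 'M[R]_(m, n)) : (1 <= p)%E -> (0 <= op_norm p q A)%E.
Proof.
move=> p1; apply: le_ereal_sup_tmp.
exists (lp_norm q (A *m 0))%:E; last by rewrite lee_fin lp_norm_ge0.
by exists 0 => //=; rewrite lp_norm0.
Qed.

(** A vector of the unit ball has coordinates at most 1 in absolute value, so [A *m z] is dominated
    entrywise by the absolute row sums of [A]. *)
Lemma op_norm_fin p q m n (A : 'M[R]_(m, n)) : (1 <= p)%E -> (1 <= q)%E ->
  op_norm p q A \is a fin_num.
Proof.
move=> p1 q1; rewrite ge0_fin_numE; last exact: op_norm_ge0.
pose c := lp_norm q (\col_i \sum_j `|A i j|).
apply: (@le_lt_trans _ _ c%:E); last by rewrite ltry.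
apply: ge_ereal_sup => _ [z /= z1 <-]; rewrite lee_fin; apply: ler_lp_norm => // i.
rewrite !mxE [leRHS]ger0_norm ?sumr_ge0 //; apply: le_trans (ler_norm_sum _ _ _) _.
apply: ler_sum => j _; rewrite normrM ler_piMr //.
exact: le_trans (lp_norm_coord _ _ p1) z1.
Qed.

(** Faithful for exponents at least 1, where [op_norm] is finite; estimates can then use the
    arithmetic of [R]. *)
Definition opn p q m n (A : 'M[R]_(m, n)) : R := fine (op_norm p q A).

Lemma opnE p q m n (A : 'M[R]_(m, n)) : (1 <= p)%E -> (1 <= q)%E ->
  (opn p q A)%:E = op_norm p q A.
Proof. by move=> p1 q1; rewrite /opn fineK // op_norm_fin. Qed.

Lemma opn_ge0 p q m n (A : 'M[R]_(m, n)) : (1 <= p)%E -> 0 <= opn p q A.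
Proof. by move=> p1; rewrite fine_ge0 // op_norm_ge0. Qed.

Lemma lp_norm_mulmx p q m n (A : 'M[R]_(m, n)) (z : 'cV[R]_n) :
  (1 <= p)%E -> (1 <= q)%E -> lp_norm q (A *m z) <= opn p q A * lp_norm p z.
Proof.
move=> p1 q1; have [z0|z0] := leP (lp_norm p z) 0.
  by rewrite (lp_norm_le0 p1 z0) mulmx0 !lp_norm0 // mulr0.
rewrite -ler_pdivrMr // mulrC -lee_fin opnE //.
apply: ereal_sup_ubound; exists ((lp_norm p z)^-1 *: z) => /=.
  by rewrite lp_normZ // gtr0_norm ?invr_gt0 // mulVf ?gt_eqF.
by rewrite -scalemxAr lp_normZ // gtr0_norm ?invr_gt0.
Qed.

(** A zero norm kills every basis vector, hence every column. It serves to show that a nonzero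
    up-projection block times [+oo] is [+oo]. *)
Lemma opn_eq0 p q m n (A : 'M[R]_(m, n)) : (1 <= p)%E -> (1 <= q)%E ->
  opn p q A = 0 -> A = 0.
Proof.
move=> p1 q1 A0; apply/matrixP => i j; rewrite mxE.
have /(lp_norm_le0 q1)/colP/(_ i) : lp_norm q (A *m delta_mx j (0 : 'I_1)) <= 0.
  by rewrite (le_trans (lp_norm_mulmx _ _ p1 q1)) // A0 mul0r.
by rewrite -colE !mxE.
Qed.

End OpNorm.

(** * Relative distances and condition numbers *)

Section Conditioning.
Variable R : realType.
Implicit Types th : metric R.

Lemma rel_dist_ge0 th n (w' w : 'cV[R]_n) : (0 <= rel_dist th w' w)%E.
Proof.
case: th => [p|] /=; last exact: bigmax_ge_id.
by rewrite mule_ge0 ?inve_ge0 ?lee_fin ?lp_norm_ge0.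
Qed.

(** The supremum is nondecreasing in [t], so its limit at 0 from the right exists and is the infimum
    over [t > 0]: one radius for each [e] is enough. *)
Lemma cond_number_le th_in th_out n m (f : 'cV[R]_n -> 'cV[R]_m) v (K : R) :
  (forall e, 0 < e -> exists2 t, 0 < t & forall v',
     (rel_dist th_in v' v <= t%:E)%E ->
     (rel_dist th_out (f v') (f v) <= (K + e)%:E * rel_dist th_in v' v)%E) ->
  0 <= K -> (cond_number th_in th_out f v <= K%:E)%E.
Proof.
move=> fK K0; rewrite /cond_number.
set g := (X in lim (X @ _)).
have nd : {in Interval (BRight 0) (BInfty R false) &,
    {homo g : s t / s <= t >-> (s <= t)%E}}.
  move=> s t _ _ st; apply: ereal_sup_le => _ [v' /= vs <-].
  by exists v' => //=; apply: le_trans vs _; rewrite lee_fin.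
have /cvg_lim -> // := nondecreasing_at_right_cvge (BInfty R false) isT nd.
apply/lee_addgt0Pr => e e0; have [t t0 ht] := fK e e0.
apply: (@le_trans _ _ (g t)).
  by apply: ereal_inf_lbound; exists t; rewrite //= in_itv /= t0.
apply: ge_ereal_sup => _ [v' /= /[dup] vt /ht out <-].
have in0 := rel_dist_ge0 th_in v' v; have out0 := rel_dist_ge0 th_out (f v') (f v).
have Ke0 : 0 <= K + e by rewrite addr_ge0 // ltW.
move: in0 vt out; case: (rel_dist th_in v' v) => [s| |] // s0 _ out.
(* At input distance 0 the assumed estimate forces output distance 0, and 0/0 is 0. *)
have [sE|sn0] := eqVneq s 0.
  have -> : rel_dist th_out (f v') (f v) = 0%E.
    by apply/eqP; rewrite eq_le out0 andbT (le_trans out) // sE mule0.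
  by rewrite mul0e -EFinD lee_fin.
have {s0}s0 : 0 < s by rewrite lt_def sn0.
by rewrite inver (negbTE sn0) -EFinD lee_pdivrMr.
Qed.

Lemma rel_dist_normwisexx p n (w : 'cV[R]_n) : (1 <= p)%E ->
  rel_dist (Normwise p) w w = 0%E.
Proof. by move=> p1; rewrite /rel_dist subrr lp_norm0 // mul0e. Qed.

Lemma rel_dist_componentwisexx n (w : 'cV[R]_n) : rel_dist Componentwise w w = 0%E.
Proof.
rewrite /rel_dist; apply/eqP; rewrite eq_le bigmax_ge_id andbT.
by apply: bigmax_le => // i _; rewrite subrr normr0 mul0e.
Qed.

(** Covers a zero input in a normwise metric: every other point is at infinite distance, so the
    supremum sees only [v]. *)
Lemma cond_number_le0 th_in th_out n m (f : 'cV[R]_n -> 'cV[R]_m) v :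
  rel_dist th_out (f v) (f v) = 0%E ->
  (forall v' (t : R), (rel_dist th_in v' v <= t%:E)%E -> v' = v) ->
  (cond_number th_in th_out f v <= 0)%E.
Proof.
move=> fv0 only; apply: cond_number_le => // e e0; exists 1 => // v' /only ->.
by rewrite fv0 mule_ge0 ?rel_dist_ge0 // lee_fin add0r ltW.
Qed.

Lemma rel_dist_normwise p n (w' w : 'cV[R]_n) : lp_norm p w != 0 ->
  rel_dist (Normwise p) w' w = (lp_norm p (w' - w) / lp_norm p w)%:E.
Proof. by move=> w0; rewrite /rel_dist inver (negbTE w0) EFinM. Qed.

Lemma rel_dist_normwise0 p n (w' : 'cV[R]_n) (t : R) : (1 <= p)%E ->
  (rel_dist (Normwise p) w' 0 <= t%:E)%E -> w' = 0.
Proof.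
move=> p1; rewrite /rel_dist subr0 lp_norm0 // inve0 => w't.
apply: (lp_norm_le0 p1); rewrite leNgt; apply/negP => w'0.
by move: w't; rewrite gt0_muley ?lte_fin.
Qed.

(** At the zeros of [w] the convention 0/0 = 0 agrees with [0^-1 = 0]; elsewhere the quotients are
    the absolute entries of the scaled difference. *)
Lemma rel_dist_componentwise n (w' w : 'cV[R]_n) :
  (forall j, w j 0 = 0 -> w' j 0 = 0) ->
  rel_dist Componentwise w' w =
    (lp_norm +oo (diagc (map_mx GRing.inv w) *m (w' - w)))%:E.
Proof.
move=> ww'; rewrite /rel_dist /lp_norm -EFin_bigmax; apply: eq_bigr => j _.
rewrite /diagc mul_diag_mx !mxE inver normr_eq0.
have [wj|wj] := eqVneq (w j 0) 0.
  by rewrite wj ww' // subrr mulr0 normr0 mul0e.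
by rewrite -EFinM normrM normfV mulrC.
Qed.

(** A nonzero entry over a zero one has relative error [+oo], so finite distance preserves zeros. *)
Lemma rel_dist_componentwise_support n (w' w : 'cV[R]_n) (t : R) :
  (rel_dist Componentwise w' w <= t%:E)%E -> forall j, w j 0 = 0 -> w' j 0 = 0.
Proof.
move=> w't j wj; apply/eqP; apply: contraTT w't => w'j; rewrite -ltNge.
apply: lt_le_trans (ltry t) _.
apply: le_trans (le_bigmax _ (fun i => (`|w' i 0 - w i 0|%:E / `|w i 0|%:E)%E) j).
by rewrite wj subr0 normr0 inve0 gt0_muley // lte_fin normr_gt0.
Qed.

(** Recovers [w'] from its vector of relative perturbations, the parameter [z] of the componentwise
    input metric. *)
Lemma diagc_invK n (w' w : 'cV[R]_n) : (forall j, w j 0 = 0 -> w' j 0 = 0) ->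
  w' = w + diagc w *m (diagc (map_mx GRing.inv w) *m (w' - w)).
Proof.
move=> ww'; apply/colP => j; rewrite /diagc !mul_diag_mx !mxE.
have [wj|wj] := eqVneq (w j 0) 0; first by rewrite wj ww' // mul0r addr0.
by rewrite mulVKf // subrKC.
Qed.

End Conditioning.

Lemma lp_norm_diagc (R : realType) (p : \bar R) n (s w : 'cV[R]_n) : (1 <= p)%E ->
  lp_norm p (diagc s *m w) <= lp_norm +oo s * lp_norm p w.
Proof.
move=> p1; have s0 : 0 <= lp_norm +oo s by exact: lp_norm_ge0.
rewrite -[X in X * _]ger0_norm // -lp_normZ //; apply: ler_lp_norm => // i.
rewrite /diagc mul_diag_mx !mxE !normrM; apply: ler_wpM2r => //.
by rewrite (ger0_norm s0) lp_norm_coord.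
Qed.

Lemma derivable_expansion (R : realType) (f : R -> R) (y e : R) :
  derivable f y 1 -> 0 < e ->
  exists2 t, 0 < t & forall k, `|k| <= t ->
    `|f (y + k) - f y - f^`()%classic y * k| <= e * `|k|.
Proof.
move=> fy e0; have := fy; rewrite /derivable => /cvgrPdist_le /(_ e e0).
rewrite near_withinE => /nbhs_ballP[t /= t0 ft].
(* The limit gives an open ball without its centre; halving the radius allows [|k| <= t], and
   [k = 0] is trivial. *)
exists (t / 2); first by rewrite divr_gt0.
move=> k kt; have [->|k0] := eqVneq k 0.
  by rewrite addr0 subrr mulr0 subr0 normr0 mulr0.
have := ft k; rewrite /ball /= sub0r normrN => /(_ _ k0).
have kt' : `|k| < t by apply: le_lt_trans kt _; lra.
move=> /(_ kt'); rewrite derive1E /derive /=; set L := lim _.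
rewrite /GRing.scale /= mulr1 [k + y]addrC distrC => fk.
rewrite -ler_pdivrMr ?normr_gt0 // -normfV -normrM; apply: le_trans fk.
by rewrite le_eqVlt; apply/orP; left; apply/eqP; congr `|_|; field.
Qed.

(** * First-order expansion of the hidden layer *)

Section Hidden.
Variables (R : realType) (d D : nat) (sigma : R -> R).
Variables (Wup Wgate : 'M[R]_(D, d)) (x : 'cV[R]_d).

Definition hidden (v : 'cV[R]_d) : 'cV[R]_D :=
  map2_mx *%R (map_mx sigma (Wgate *m v)) (Wup *m v).

(** The derivative of [hidden] at [x] in direction [h], by the product rule. The activation values
    stand leftmost, so that their maximum can be pulled out. *)
Definition dhidden (h : 'cV[R]_d) : 'cV[R]_D :=
  diagc (map_mx sigma^`()%classic (Wgate *m x)) *m (diagc (Wup *m x) *m (Wgate *m h))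
  + diagc (map_mx sigma (Wgate *m x)) *m (Wup *m h).

Lemma hiddenE v i : hidden v i 0 = sigma ((Wgate *m v) i 0) * (Wup *m v) i 0.
Proof. by rewrite /hidden !mxE. Qed.

Lemma dhiddenE h i : dhidden h i 0 =
  sigma^`()%classic ((Wgate *m x) i 0) * ((Wup *m x) i 0 * (Wgate *m h) i 0)
  + sigma ((Wgate *m x) i 0) * (Wup *m h) i 0.
Proof. by rewrite /dhidden /diagc !mul_diag_mx !mxE. Qed.

(** With [E] the Taylor remainder of [sigma], the error of the product is
    [E * (u + l) + c * (k * l)]: the first summand is small by [e], the second is quadratic in the
    perturbation size [T]. *)
Lemma product_remainder (y u k l a c e C T : R) : 0 <= C -> 0 <= T -> 0 <= e ->
  `|k| <= C * T -> `|l| <= C * T -> `|sigma (y + k) - a - c * k| <= e * `|k| ->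
  `|sigma (y + k) * (u + l) - a * u - (c * (u * k) + a * l)|
  <= (e * (C * (`|u| + C * T)) + T * (`|c| * C ^+ 2)) * T.
Proof.
move=> C0 T0 e0 kT lT; set E := sigma _ - a - c * k => Ek.
have -> : sigma (y + k) * (u + l) - a * u - (c * (u * k) + a * l)
    = E * (u + l) + c * (k * l) by rewrite /E; ring.
apply: le_trans (ler_normD _ _) _; rewrite !normrM mulrDl; apply: lerD.
  have -> : e * (C * (`|u| + C * T)) * T = (e * (C * T)) * (`|u| + C * T) by ring.
  apply: ler_pM => //; last by rewrite (le_trans (ler_normD _ _)) // lerD2l.
  by rewrite (le_trans Ek) // ler_wpM2l.
have -> : T * (`|c| * C ^+ 2) * T = `|c| * ((C * T) * (C * T)) by ring.
by rewrite ler_wpM2l // ler_pM.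
Qed.

Lemma hidden_expansion (e : R) : (forall y, derivable sigma y 1) -> 0 < e ->
  exists2 t, 0 < t & forall h, lp_norm +oo h <= t ->
    lp_norm +oo (hidden (x + h) - hidden x - dhidden h) <= e * lp_norm +oo h.
Proof.
move=> dsigma e0.
(* The sum of the norms bounds the increments of both linear maps at once. *)
pose C := opn +oo +oo Wgate + opn +oo +oo Wup.
have G0 : 0 <= opn +oo +oo Wgate by apply: opn_ge0.
have U0 : 0 <= opn +oo +oo Wup by apply: opn_ge0.
have C0 : 0 <= C by rewrite addr_ge0.
pose P i t := 0 < t /\ forall h, lp_norm +oo h <= t ->
  `|(hidden (x + h) - hidden x - dhidden h) i 0| <= e * lp_norm +oo h.
have /fin_all_exists[t Pt] : forall i, exists t, P i t.
  move=> i; pose y := (Wgate *m x) i 0; pose u := (Wup *m x) i 0.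
  pose c := sigma^`()%classic y.
  (* For [T <= 1], [A] and [B] dominate the two coefficients in [product_remainder]; the added 1
     makes them positive divisors. Each summand gets the share [e / 2]. *)
  pose A := C * (`|u| + C) + 1; pose B := `|c| * C ^+ 2 + 1.
  have A0 : 0 < A by rewrite ltr_wpDl // mulr_ge0 // addr_ge0.
  have B0 : 0 < B by rewrite ltr_wpDl // mulr_ge0 // exprn_ge0.
  have C10 : 0 < C + 1 by rewrite ltr_wpDl.
  have [|t1 t10 ht1] := @derivable_expansion R sigma y (e / 2 / A) (dsigma y).
    by rewrite !divr_gt0.
  (* The three radii give [T <= 1], an increment of [y] of size at most [t1], and a quadratic term
     of at most [e / 2]. *)
  exists (Num.min 1 (Num.min (t1 / (C + 1)) (e / 2 / B))); split.
    by rewrite !lt_min ltr01 !divr_gt0.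
  move=> h; rewrite !le_min => /and3P[hs1 hs2 hs3].
  set T := lp_norm +oo h in hs1 hs2 hs3 *.
  have T0 : 0 <= T by exact: lp_norm_ge0.
  have kT : `|(Wgate *m h) i 0| <= C * T.
    apply: le_trans (lp_norm_coord (p := +oo) _ _ _) _ => //.
    apply: le_trans (lp_norm_mulmx (p := +oo) _ _ _ _) _ => //.
    by apply: ler_wpM2r => //; rewrite lerDl.
  have lT : `|(Wup *m h) i 0| <= C * T.
    apply: le_trans (lp_norm_coord (p := +oo) _ _ _) _ => //.
    apply: le_trans (lp_norm_mulmx (p := +oo) _ _ _ _) _ => //.
    by apply: ler_wpM2r => //; rewrite lerDr.
  have kt1 : `|(Wgate *m h) i 0| <= t1.
    apply: le_trans kT _; move: hs2; rewrite ler_pdivlMr // => hs2.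
    by apply: le_trans hs2; rewrite mulrC ler_wpM2l // lerDl.
  have e20 : 0 <= e / 2 / A by rewrite !divr_ge0 // ltW.
  have := product_remainder u C0 T0 e20 kT lT (ht1 _ kt1).
  have subE (a b w : 'cV[R]_D) : (a - b - w) i 0 = a i 0 - b i 0 - w i 0.
    by rewrite !mxE.
  have addE (a b : 'cV[R]_D) : (a + b) i 0 = a i 0 + b i 0 by rewrite !mxE.
  rewrite subE !hiddenE dhiddenE !mulmxDr !addE -/y -/u -/c => rem.
  apply: le_trans rem _; apply: ler_wpM2r => //.
  rewrite [leRHS](_ : e = e / 2 / A * A + e / 2 / B * B); last first.
    by rewrite !divfK ?gt_eqF //; lra.
  apply: lerD.
    apply: ler_wpM2l => //; rewrite /A ler_wpDr // ler_wpM2l // lerD2l.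
    by rewrite -[leRHS]mulr1 ler_wpM2l.
  by apply: ler_pM => //; rewrite ?mulr_ge0 ?exprn_ge0 // /B lerDl.
(* The default 1 keeps the radius positive also when [D = 0]. *)
exists (\big[Num.min/1]_i t i).
  by apply: lt_bigmin => // i _; have [] := Pt i.
move=> h ht; apply: linf_norm_le => [|i].
  by apply: mulr_ge0; [exact: ltW | exact: lp_norm_ge0].
have [_] := Pt i; apply; apply: le_trans ht _.
exact: (bigmin_le _ i t).
Qed.

End Hidden.

(** * Splitting over the regions and the Lipschitz constant of the linearization *)

Section Core.
Variables (R : realType) (d D m n : nat) (sigma : R -> R).
Variables (Wup Wgate : 'M[R]_(D, d)) (x : 'cV[R]_d) (tau : R).
Hypothesis tau_gt0 : 0 < tau.

Local Notation Om th := (Omega Wgate x tau th).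

(** [Wdown_at] for a general matrix, because the componentwise output metric replaces [Wdown] by its
    row-scaled version. *)
Definition cols_at k th (M : 'M[R]_(k, D)) : 'M[R]_(k, #|Om th|) :=
  colsub enum_val M.
Definition up_at th := Wup_at Wup Wgate x tau th.
Definition gate_at th := Wgate_at Wgate x tau th.

(** The three regions partition the hidden indices; [tau > 0] keeps [Neg] and [Pos] disjoint. *)
Lemma mulmx_regions k (M : 'M[R]_(k, D)) (w : 'cV[R]_D) :
  M *m w = \sum_(th <- [:: Neg; Mid; Pos]) cols_at th M *m rowsub enum_val w.
Proof.
have tau0 : 0 < tau by [].
apply/colP => i; rewrite summxE !big_cons big_nil addr0.
have colE th : (cols_at th M *m rowsub enum_val w) i 0 =
    \sum_(j in Om th) M i j * w j 0.
  rewrite big_enum_val mxE; apply: eq_bigr => j _; by rewrite !mxE.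
rewrite !colE mxE ![\sum_(j in _) _]big_mkcond -!big_split /=.
apply: eq_bigr => j _; rewrite !inE; move: ((Wgate *m x) j 0 : R) => y.
have [y1|y1] := ltP y (- tau).
  have -> : (`|y| <= tau) = false by rewrite ler_norml; apply/negP => /andP[? ?]; lra.
  have -> : (tau < y) = false by apply/negbTE; rewrite -leNgt; lra.
  by rewrite !addr0.
have [y2|y2] := ltP tau y.
  have -> : (`|y| <= tau) = false by rewrite ler_norml; apply/negP => /andP[? ?]; lra.
  by rewrite !add0r.
have -> : `|y| <= tau by rewrite ler_norml; apply/andP; split; lra.
by rewrite add0r addr0.
Qed.

Definition dsup th : R :=
  lp_norm +oo (rowsub (enum_val (A := pred_of_set (Om th)))
                 (map_mx sigma^`()%classic (Wgate *m x))).
Definition vsup th : R :=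
  lp_norm +oo (rowsub (enum_val (A := pred_of_set (Om th)))
                 (map_mx sigma (Wgate *m x))).

Variables (p q r : \bar R).
Hypotheses (p1 : (1 <= p)%E) (q1 : (1 <= q)%E) (r1 : (1 <= r)%E).
Variables (M : 'M[R]_(m, D)) (N : 'M[R]_(d, n)).

(** With [N] the identity or [diagc x], and [M] equal to [Wdown] or its row-scaled version, this and
    [up_term] cover the nu, xi, eta and chi quantities at once. *)
Definition gate_term th : R := opn r q (cols_at th M) *
  opn p r (diagc (up_at th *m x) *m gate_at th *m N).
Definition up_term th : R := opn r q (cols_at th M) * opn p r (up_at th *m N).

Definition lipschitz_const : R :=
  \sum_(th <- [:: Neg; Mid; Pos]) (dsup th * gate_term th + vsup th * up_term th).

Lemma gate_term_ge0 th : 0 <= gate_term th.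
Proof. by rewrite mulr_ge0 // opn_ge0. Qed.

Lemma up_term_ge0 th : 0 <= up_term th.
Proof. by rewrite mulr_ge0 // opn_ge0. Qed.

Lemma dsup_ge0 th : 0 <= dsup th. Proof. exact: lp_norm_ge0. Qed.
Lemma vsup_ge0 th : 0 <= vsup th. Proof. exact: lp_norm_ge0. Qed.

Lemma lipschitz_const_ge0 : 0 <= lipschitz_const.
Proof.
apply: sumr_ge0 => th _; apply: addr_ge0; apply: mulr_ge0;
  by rewrite ?dsup_ge0 ?vsup_ge0 ?gate_term_ge0 ?up_term_ge0.
Qed.

Lemma rowsub_diagc k (s : 'I_k -> 'I_D) (c w : 'cV[R]_D) :
  rowsub s (diagc c *m w) = diagc (rowsub s c) *m rowsub s w.
Proof. by apply/colP => i; rewrite /diagc !mul_diag_mx !mxE. Qed.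

(** Each region factors through the intermediate norm of exponent [r], on which a diagonal matrix
    acts with norm at most its largest entry. *)
Lemma lp_norm_dhidden (z : 'cV[R]_n) :
  lp_norm q (M *m dhidden sigma Wup Wgate x (N *m z)) <= lipschitz_const * lp_norm p z.
Proof.
rewrite mulmx_regions (le_trans (lp_norm_sum _ _ _ q1)) // mulr_suml.
apply: ler_sum => th _; apply: le_trans (lp_norm_mulmx _ _ r1 q1) _.
rewrite mulrDl /gate_term /up_term.
set c := opn r q _; have c0 : 0 <= c by exact: opn_ge0.
rewrite !(mulrCA _ c) -!(mulrA c) -mulrDr; apply: ler_wpM2l => //.
rewrite /dhidden linearD /= !rowsub_diagc -!mul_rowsub_mx.
apply: le_trans (lp_normD _ _ r1) _; apply: lerD.
  apply: le_trans (lp_norm_diagc _ _ r1) _; rewrite -mulrA.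
  apply: ler_wpM2l; first exact: dsup_ge0.
  by rewrite !mulmxA lp_norm_mulmx.
apply: le_trans (lp_norm_diagc _ _ r1) _; rewrite -mulrA.
apply: ler_wpM2l; first exact: vsup_ge0.
by rewrite !mulmxA lp_norm_mulmx.
Qed.

Lemma lp_norm_hidden_local (e : R) : (forall y, derivable sigma y 1) -> 0 < e ->
  exists2 t, 0 < t & forall z, lp_norm p z <= t ->
    lp_norm q (M *m (hidden sigma Wup Wgate (x + N *m z) - hidden sigma Wup Wgate x))
    <= (lipschitz_const + e) * lp_norm p z.
Proof.
move=> dsigma e0; set C := opn +oo q M; set C' := opn p +oo N.
have C0 : 0 <= C by exact: opn_ge0.
have C'0 : 0 <= C' by exact: opn_ge0.
have CC0 : 0 < C * C' + 1 by rewrite ltr_wpDl // mulr_ge0.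
have C'10 : 0 < C' + 1 by rewrite ltr_wpDl.
(* The remainder is estimated in the max norm; passing to exponents [p] and [q] costs [C * C'],
   which this tolerance absorbs. *)
have e'0 : 0 < e / (C * C' + 1) by rewrite divr_gt0.
have [t t0 ht] := hidden_expansion Wup Wgate x dsigma e'0.
(* This radius ensures that [N *m z] has max norm at most [t]. *)
exists (t / (C' + 1)); first by rewrite divr_gt0.
move=> z; rewrite ler_pdivlMr // => zt.
have z0 : 0 <= lp_norm p z by exact: lp_norm_ge0.
have Nz : lp_norm +oo (N *m z) <= C' * lp_norm p z by rewrite lp_norm_mulmx.
have {}ht := ht (N *m z) (le_trans Nz _).
set w := _ - _; set w' := dhidden sigma Wup Wgate x (N *m z) in ht *.
rewrite -(subrK w' w) addrC mulmxDr mulrDl (le_trans (lp_normD _ _ q1)) // lerD //.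
  exact: lp_norm_dhidden.
apply: le_trans (lp_norm_mulmx (p := +oo) _ _ _ q1) _ => //.
have {}ht : lp_norm +oo (w - w') <= e / (C * C' + 1) * (C' * lp_norm p z).
  apply: le_trans (ht _) _; last by rewrite ler_wpM2l // ltW.
  by rewrite (le_trans _ zt) // mulrC ler_wpM2l // lerDl.
apply: le_trans (ler_wpM2l C0 ht) _.
rewrite [leLHS](_ : _ = (e * (C * C') / (C * C' + 1)) * lp_norm p z); last first.
  by field; rewrite gt_eqF.
by rewrite ler_wpM2r // ler_pdivrMr // ler_wpM2l ?lerDl // ltW.
Qed.

(** * Bounds for [sigma] and its derivative on the three regions *)

Lemma linf_norm_le_ereal k (v : 'cV[R]_k) (c : \bar R) : (0 <= c)%E ->
  (forall i, (`|v i 0|%:E <= c)%E) -> ((lp_norm +oo v)%:E <= c)%E.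
Proof.
by move=> c0 vc; rewrite /= -EFin_bigmax; apply: bigmax_le => // i _.
Qed.

Lemma sup_norm_ge0 (h : R -> R) : (0 <= sup_norm h `[(- tau)%R, tau]%classic)%E.
Proof.
apply: le_ereal_sup_tmp; exists `|h 0|%:E; last by rewrite lee_fin.
by exists 0 => //=; rewrite in_itv /= oppr_le0 !ltW.
Qed.

Lemma rowsub_mid_sup (h : R -> R) :
  ((lp_norm +oo (rowsub (enum_val (A := pred_of_set (Om Mid)))
      (map_mx h (Wgate *m x))))%:E <= sup_norm h `[(- tau)%R, tau]%classic)%E.
Proof.
apply: linf_norm_le_ereal => [|i]; first exact: sup_norm_ge0.
have := enum_valP i; rewrite inE ler_norml => yi; rewrite mxE [map_mx _ _ _ _]mxE.
by apply: ereal_sup_ubound; exists ((Wgate *m x) (enum_val i) 0).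
Qed.

Variable eps : R.
Hypotheses (eps_gt0 : 0 < eps) (sigma_eps : relu_threshold sigma eps tau).

Lemma neg_sup : dsup Neg <= eps /\ vsup Neg <= eps.
Proof.
have [_ neg _] := sigma_eps.
split; apply: linf_norm_le => [|i]; rewrite ?(ltW eps_gt0) //;
  have := enum_valP i; rewrite inE => /neg; rewrite gt_max => /andP[s s'];
  by rewrite mxE [map_mx _ _ _ _]mxE ltW.
Qed.

(** Here [sigma] is close to the identity rather than bounded: [|sigma y| <= (1 + eps) * |y|], which
    is where the max norm of the gate values comes from. *)
Lemma pos_sup : dsup Pos <= 1 + eps /\
  vsup Pos <= (1 + eps) * lp_norm +oo (gate_at Pos *m x).
Proof.
have [t0 _ pos] := sigma_eps.
have eps1 : 0 <= 1 + eps by rewrite addr_ge0 // ltW.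
split; apply: linf_norm_le => [|i] //.
- have := enum_valP i; rewrite inE => yi; have := pos _ yi.
  rewrite gt_max => /andP[_ s]; rewrite mxE [map_mx _ _ _ _]mxE.
  set y := (Wgate *m x) _ _ in s *.
  by rewrite -(subrK 1 (_ y)) (le_trans (ler_normD _ _)) // normr1 addrC lerD2l ltW.
- by apply: mulr_ge0 => //; exact: lp_norm_ge0.
- have := enum_valP i; rewrite inE => yi; have := pos _ yi.
  rewrite gt_max => /andP[s _]; rewrite mxE [map_mx _ _ _ _]mxE.
  have y0 := lt_trans t0 yi; move: s yi y0.
  set y := (Wgate *m x) _ _ => s yi y0.
  apply: (@le_trans _ _ ((1 + eps) * `|y|)); last first.
    apply: ler_wpM2l => //; have := @lp_norm_coord R +oo _ (gate_at Pos *m x) i.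
    by rewrite /gate_at /Wgate_at mul_rowsub_mx mxE; apply.
  rewrite -ler_pdivrMr ?normr_gt0 ?gt_eqF // -normf_div.
  by rewrite -(subrK 1 (sigma y / y)) (le_trans (ler_normD _ _)) // normr1 addrC lerD2l ltW.
Qed.

(** * Comparison of [lipschitz_const] with [bound_factor] *)

Lemma le_mule_ytop (a : \bar R) (b : R) (a' b' : \bar R) : (0 <= a)%E -> 0 <= b ->
  (a <= a')%E -> (b%:E <= b')%E -> (a * b%:E <= mule_ytop a' b')%E.
Proof.
move=> a0 b0 aa bb; rewrite /mule_ytop; case: eqP => _; first exact: leey.
by apply: lee_pmul.
Qed.

Lemma mule_ytop_ge0 (a b : \bar R) : (0 <= a)%E -> (0 <= b)%E -> (0 <= mule_ytop a b)%E.
Proof. by move=> a0 b0; rewrite /mule_ytop; case: ifP => // _; exact: mule_ge0. Qed.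

(** Compares region by region. Inequalities on [nu] and [nu_t] leave room for the value [+oo] of
    [op_norm_idiag]. *)
Lemma le_bound_factor (nu nu_t : region -> \bar R) :
  (forall th, ((gate_term th)%:E <= nu th)%E) ->
  (forall th, ((up_term th)%:E <= nu_t th)%E) ->
  (lipschitz_const%:E <= bound_factor sigma Wgate x tau eps nu nu_t)%E.
Proof.
move=> gn un; rewrite /lipschitz_const !big_cons big_nil addr0.
have [dn vn] := neg_sup; have [dp vp] := pos_sup.
have eps1 : 0 <= 1 + eps by rewrite addr_ge0 // ltW.
have g0 th : 0 <= gate_term th := gate_term_ge0 th.
have u0 th : 0 <= up_term th := up_term_ge0 th.
have d0 th : 0 <= dsup th := dsup_ge0 th.
have v0 th : 0 <= vsup th := vsup_ge0 th.
have n0 th : (0 <= nu th)%E by apply: le_trans (gn th); rewrite lee_fin.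
have nt0 th : (0 <= nu_t th)%E by apply: le_trans (un th); rewrite lee_fin.
rewrite /bound_factor addrA !(EFinD (_ + _)) !(EFinD (dsup _ * _)) -[X in (_ <= X + _)%E]addeA.
apply: leeD; first apply: leeD.
- rewrite muleDr ?ge0_adde_def ?inE // (EFinM (dsup _)) (EFinM (vsup _)).
  by apply: leeD; apply: lee_pmul; rewrite ?lee_fin.
- rewrite (EFinM (dsup _)) (EFinM (vsup _)); apply: leeD;
    apply: le_mule_ytop; rewrite ?lee_fin //.
    exact: rowsub_mid_sup.
  exact: rowsub_mid_sup.
- have l0 : (0 <= (lp_norm +oo (Wgate_at Wgate x tau Pos *m x))%:E)%E.
    by rewrite lee_fin; exact: lp_norm_ge0.
  rewrite muleDr //; last by apply: ge0_adde_def; rewrite inE ?mule_ge0.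
  rewrite muleA (EFinM (dsup _)) (EFinM (vsup _)).
  by apply: leeD; apply: lee_pmul; rewrite -?EFinM ?lee_fin.
Qed.

(** The infinite term survives its coefficient: [eps > 0] on [Neg], the convention of [mule_ytop] on
    [Mid], and on a nonempty [Pos] a gate value above [tau > 0]. *)
Lemma bound_factor_pinfty (nu nu_t : region -> \bar R) th :
  (forall th, (0 <= nu th)%E) -> (forall th, (0 <= nu_t th)%E) ->
  (0 < #|Om th|)%N -> nu_t th = +oo%E ->
  bound_factor sigma Wgate x tau eps nu nu_t = +oo%E.
Proof.
move=> n0 nt0 Om0 ntoo; rewrite /bound_factor.
have e0 : 0 <= eps by exact: ltW.
have l0 : (0 <= (lp_norm +oo (Wgate_at Wgate x tau Pos *m x))%:E)%E.
  by rewrite lee_fin; exact: lp_norm_ge0.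
have eps1 : 0 < 1 + eps by rewrite addr_gt0.
have Ny (a : \bar R) : (0 <= a)%E -> a != -oo%E by case: a.
have neg0 : (0 <= eps%:E * (nu Neg + nu_t Neg))%E.
  by rewrite mule_ge0 ?lee_fin ?adde_ge0.
have mid0 := mule_ytop_ge0 (sup_norm_ge0 sigma^`()%classic) (n0 Mid).
have midt0 := mule_ytop_ge0 (sup_norm_ge0 sigma) (nt0 Mid).
have pos0 : (0 <= nu Pos + (lp_norm +oo (Wgate_at Wgate x tau Pos *m x))%:E
    * nu_t Pos)%E by rewrite adde_ge0 ?mule_ge0.
have pos1 : (0 <= (1 + eps)%:E * (nu Pos + (lp_norm +oo (Wgate_at Wgate x tau Pos *m x))%:E
    * nu_t Pos))%E by rewrite mule_ge0 // lee_fin ltW.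
case: th Om0 ntoo => Om0 ntoo.
- rewrite ntoo addey ?Ny // gt0_muley ?lte_fin // !addye ?Ny //.
- rewrite [mule_ytop _ (nu_t Mid)]/mule_ytop ntoo eqxx.
  by rewrite addey ?Ny ?addye ?Ny ?adde_ge0.
- have lpos : (0 < (lp_norm +oo (Wgate_at Wgate x tau Pos *m x))%:E)%E.
    have t0 : 0 < tau by [].
    rewrite lte_fin; have := @lp_norm_coord R +oo _ (gate_at Pos *m x) (Ordinal Om0).
    rewrite /gate_at /Wgate_at mul_rowsub_mx mxE => /(_ (leey _)).
    apply: lt_le_trans; have := enum_valP (Ordinal Om0); rewrite inE => yi.
    by rewrite normr_gt0 gt_eqF // (lt_trans t0).
  rewrite ntoo gt0_muley // addey ?Ny // gt0_muley ?lte_fin //.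
  by rewrite addey // Ny // !adde_ge0.
Qed.

(** Reduces all metrics to norms: [s] rescales the input error and [b] the output error, each being
    a norm (or its inverse) in the normwise case and 1 in the componentwise case. *)
Lemma cond_number_hidden (th_in th_out : metric R) k (f : 'cV[R]_d -> 'cV[R]_k)
    (s b : R) : (forall y, derivable sigma y 1) -> 0 < s -> 0 <= b ->
  (forall v' (t : R), (rel_dist th_in v' x <= t%:E)%E ->
     exists z, [/\ v' = x + N *m z,
       rel_dist th_in v' x = (lp_norm p z / s)%:E &
       (rel_dist th_out (f v') (f x) <= (b * lp_norm q
         (M *m (hidden sigma Wup Wgate v' - hidden sigma Wup Wgate x)))%:E)%E]) ->
  (cond_number th_in th_out f x <= (lipschitz_const * (b * s))%:E)%E.
Proof.
move=> dsigma s0 b0 param.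
have bs0 : 0 <= b * s by rewrite mulr_ge0 // ltW.
have bs1 : 0 < b * s + 1 by rewrite ltr_wpDl.
apply: cond_number_le; last by rewrite mulr_ge0 ?lipschitz_const_ge0.
(* After multiplication by [b * s] this tolerance is still at most [e]. *)
move=> e e0; have [|t t0 ht] := @lp_norm_hidden_local (e / (b * s + 1)) dsigma.
  by rewrite divr_gt0.
exists (t / s); first by rewrite divr_gt0.
move=> v' v't; have [z [v'E in_ out]] := param v' _ v't.
move: v't; rewrite in_ lee_fin ler_pdivlMr // divfK ?gt_eqF // => zt.
apply: le_trans out _; rewrite -EFinM lee_fin v'E.
apply: le_trans (ler_wpM2l b0 (ht z zt)) _.
have -> : b * ((lipschitz_const + e / (b * s + 1)) * lp_norm p z) =
    ((lipschitz_const + e / (b * s + 1)) * (b * s)) * (lp_norm p z / s).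
  by field; rewrite !gt_eqF.
apply: ler_wpM2r; first by rewrite divr_ge0 ?lp_norm_ge0 // ltW.
rewrite mulrDl lerD2l -mulrA ler_piMr // ?(ltW e0) //.
by rewrite mulrC ler_pdivrMr // mul1r lerDl.
Qed.

End Core.

(** * Bounds for each output metric, with the input metric given by [param] *)

Section FeedForward.
Variables (R : realType) (d D n : nat) (sigma : R -> R).
Variables (Wup Wgate : 'M[R]_(D, d)) (Wdown : 'M[R]_(d, D)) (x : 'cV[R]_d).
Variables (eps tau : R) (p q r : \bar R) (N : 'M[R]_(d, n)).
Hypotheses (dsigma : forall y, derivable sigma y 1) (eps0 : 0 < eps).
Hypothesis sigma_eps : relu_threshold sigma eps tau.
Hypotheses (p1 : (1 <= p)%E) (q1 : (1 <= q)%E) (r1 : (1 <= r)%E).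
Variables (th_in : metric R) (s : R).
Hypothesis s0 : 0 < s.
Hypothesis param : forall v' (t : R), (rel_dist th_in v' x <= t%:E)%E ->
  exists2 z, v' = x + N *m z & rel_dist th_in v' x = (lp_norm p z / s)%:E.

Local Notation F := (FG sigma Wup Wgate Wdown).
Local Notation B := (bound_factor sigma Wgate x tau eps).
Local Notation hid := (hidden sigma Wup Wgate).
Local Notation down := (Wdown_at Wgate Wdown x tau).
Local Notation gate_norm th := (op_norm p r
  (diagc (Wup_at Wup Wgate x tau th *m x) *m Wgate_at Wgate x tau th *m N)).
Local Notation up_norm th := (op_norm p r (Wup_at Wup Wgate x tau th *m N)).

Let tau0 : 0 < tau. Proof. by have [] := sigma_eps. Qed.

Lemma FG_sub v' : F v' - F x = Wdown *m (hid v' - hid x).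
Proof. by rewrite mulmxBr. Qed.

Lemma cond_number_normwise_out : lp_norm q (F x) != 0 ->
  (cond_number th_in (Normwise q) F x <=
   mule_ytop (B (fun th => op_norm r q (down th) * gate_norm th)
                (fun th => op_norm r q (down th) * up_norm th))
             (s%:E / (lp_norm q (F x))%:E))%E.
Proof.
move=> Fx0; have lF0 : 0 < lp_norm q (F x) by rewrite lt_def Fx0 lp_norm_ge0.
have b0 : 0 <= (lp_norm q (F x))^-1 by rewrite invr_ge0 ltW.
have bs0 : 0 <= s / lp_norm q (F x) by rewrite divr_ge0 // ltW.
apply: (@le_trans _ _ (lipschitz_const sigma Wup Wgate x tau p q r Wdown N
    * (s / lp_norm q (F x)))%:E).
  rewrite [s / _]mulrC; apply: cond_number_hidden => // v' t /param[z v'E in_].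
  exists z; split=> //; rewrite rel_dist_normwise // FG_sub lee_fin.
  by rewrite mulrC.
rewrite EFinM inver (negbTE Fx0) -(EFinM s); apply: le_mule_ytop => //.
  by rewrite lee_fin lipschitz_const_ge0.
apply: le_bound_factor => // th; rewrite EFinM !opnE //.
Qed.

Lemma op_norm_le_idiag th :
  (op_norm r +oo (diagc (map_mx GRing.inv (F x)) *m down th) <=
   op_norm_idiag r +oo (F x) (down th))%E.
Proof. by rewrite /op_norm_idiag; case: ifP => // _; exact: leey. Qed.

Lemma op_norm_idiag_ge0 th : (0 <= op_norm_idiag r +oo (F x) (down th))%E.
Proof. exact: le_trans (op_norm_ge0 _ _ r1) (op_norm_le_idiag th). Qed.

(* If the hypothesis on Wup_at fails, then the componentwise bound is infinite. *)
Lemma FG_support : (exists z0, x = N *m z0) ->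
  (forall th, op_norm_idiag r +oo (F x) (down th) = +oo%E ->
     Wup_at Wup Wgate x tau th *m N = 0) ->
  forall z j, F x j 0 = 0 -> F (x + N *m z) j 0 = 0.
Proof.
(* As [x] lies in the range of [N], so does the perturbed point; hence a vanishing [Wup_at *m N]
   annihilates its whole block of the hidden layer. *)
move=> [z0 xN] supp z j Fxj; have -> : x + N *m z = N *m (z0 + z) by rewrite mulmxDr -xN.
rewrite -[F _]/(Wdown *m hid _) (mulmx_regions Wgate x tau0) summxE.
apply: big1 => th _; have [row0|row0] := eqVneq (row j (down th)) 0.
  rewrite mxE big1 // => i _; move/rowP/(_ i): row0.
  by rewrite !mxE => ->; rewrite mul0r.
(* A zero of [F x] facing a nonzero row of the block is exactly what makes [op_norm_idiag]
   infinite. *)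
have up0 : Wup_at Wup Wgate x tau th *m N = 0.
  apply: supp; rewrite /op_norm_idiag; case: existsP => // -[].
  by exists j; rewrite Fxj eqxx row0.
rewrite mxE big1 // => i _.
have : (Wup_at Wup Wgate x tau th *m N *m (z0 + z)) i 0 = 0.
  by rewrite up0 mul0mx mxE.
rewrite -mulmxA mul_rowsub_mx [X in X = _]mxE => up0i.
by rewrite [X in _ * X]mxE hiddenE up0i !mulr0.
Qed.

Lemma cond_number_componentwise_out : (exists z0, x = N *m z0) ->
  (cond_number th_in Componentwise F x <=
   B (fun th => op_norm_idiag r +oo (F x) (down th) * gate_norm th)
     (fun th => op_norm_idiag r +oo (F x) (down th) * up_norm th) * s%:E)%E.
Proof.
move=> xN.
have i0 := op_norm_idiag_ge0.
have g0 th : (0 <= gate_norm th)%E by exact: op_norm_ge0.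
have u0 th : (0 <= up_norm th)%E by exact: op_norm_ge0.
(* Either some block makes the bound infinite, or the zeros of [F x] persist and the output distance
   is a max norm. *)
have [[th [ioo up0]]|] := pselect (exists th,
    op_norm_idiag r +oo (F x) (down th) = +oo%E /\ Wup_at Wup Wgate x tau th *m N <> 0).
  rewrite (@bound_factor_pinfty _ _ _ _ _ _ _ tau0 _ eps0 _ _ th) => [||||].
  - by rewrite gt0_mulye ?lte_fin ?leey.
  - by move=> ?; exact: mule_ge0.
  - by move=> ?; exact: mule_ge0.
  (* An empty region would give a matrix without rows, which is zero. *)
  - rewrite lt0n; apply/eqP => Om0; apply: up0; apply/matrixP => i.
    by have := ltn_ord i; rewrite {2}Om0.
  - rewrite ioo gt0_mulye // lt_def u0 andbT -opnE // eqe; apply/eqP => /opn_eq0.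
    by move=> up00; apply: up0; exact: up00.
move=> nex; have supp th : op_norm_idiag r +oo (F x) (down th) = +oo%E ->
    Wup_at Wup Wgate x tau th *m N = 0.
  by move=> ioo; apply: contrapT => up0; apply: nex; exists th.
set M := diagc (map_mx GRing.inv (F x)) *m Wdown.
apply: (@le_trans _ _ (lipschitz_const sigma Wup Wgate x tau p +oo r M N * s)%:E).
  rewrite -[s in X in (_ <= X)%E]mul1r.
  apply: cond_number_hidden => // v' t /param[z v'E in_].
  exists z; split=> //; rewrite rel_dist_componentwise.
    by rewrite FG_sub mulmxA mul1r.
  by move=> j; rewrite v'E; exact: FG_support.
rewrite EFinM; apply: lee_wpmul2r; first by rewrite lee_fin ltW.
have colsM th : cols_at Wgate x tau th M =
    diagc (map_mx GRing.inv (F x)) *m down th by rewrite /cols_at -mulmx_colsub.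
apply: le_bound_factor => // th; rewrite EFinM !opnE // colsM;
  by rewrite lee_wpmul2r ?op_norm_le_idiag.
Qed.

End FeedForward.

Theorem theorem4p3 (R : realType) (d D : nat) (sigma : R -> R)
    (Wup Wgate : 'M[R]_(D, d)) (Wdown : 'M[R]_(d, D)) (x : 'cV[R]_d)
    (eps tau : R) (p q r : \bar R) :
  smooth sigma -> relu_like sigma ->
  0 < eps -> relu_threshold sigma eps tau ->
  (1 <= p)%E -> (1 <= q)%E -> (1 <= r)%E ->
  let F := FG sigma Wup Wgate Wdown in
  let B := bound_factor sigma Wgate x tau eps in
  [/\ (cond_number (Normwise p) (Normwise q) F x
       <= mule_ytop (B (fg_nu Wup Wgate Wdown x tau p q r)
                   (fg_nu_t Wup Wgate Wdown x tau p q r))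
                ((lp_norm p x)%:E / (lp_norm q (F x))%:E))%E,
      (cond_number Componentwise (Normwise q) F x
       <= mule_ytop (B (fg_xi Wup Wgate Wdown x tau q r)
                   (fg_xi_t Wup Wgate Wdown x tau q r))
                (1 / (lp_norm q (F x))%:E))%E,
      (cond_number (Normwise p) Componentwise F x
       <= B (fg_eta sigma Wup Wgate Wdown x tau p r)
            (fg_eta_t sigma Wup Wgate Wdown x tau p r)
          * (lp_norm p x)%:E)%E
    & (cond_number Componentwise Componentwise F x
       <= B (fg_chi sigma Wup Wgate Wdown x tau r)
            (fg_chi_t sigma Wup Wgate Wdown x tau r))%E].
Proof.
move=> smooth_sigma _ eps0 sigma_eps p1 q1 r1 F B.
have dsigma y : derivable sigma y 1 by exact: (smooth_sigma 0%N y).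
have param_n : 0 < lp_norm p x -> forall v' (t : R),
    (rel_dist (Normwise p) v' x <= t%:E)%E ->
    exists2 z, v' = x + 1%:M *m z &
      rel_dist (Normwise p) v' x = (lp_norm p z / lp_norm p x)%:E.
  move=> x0 v' t _; exists (v' - x); first by rewrite mul1mx subrKC.
  by rewrite rel_dist_normwise ?gt_eqF.
have param_c v' (t : R) : (rel_dist Componentwise v' x <= t%:E)%E ->
    exists2 z, v' = x + diagc x *m z &
      rel_dist Componentwise v' x = (lp_norm +oo z / 1)%:E.
  move=> /rel_dist_componentwise_support supp.
  exists (diagc (map_mx GRing.inv x) *m (v' - x)); first exact: diagc_invK.
  by rewrite divr1 rel_dist_componentwise.
(* The case [x = 0], where both the condition number and the bound are 0. *)
have only0 : lp_norm p x <= 0 -> forall v' (t : R),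
    (rel_dist (Normwise p) v' x <= t%:E)%E -> v' = x.
  by move=> /(lp_norm_le0 p1) -> v' t /(rel_dist_normwise0 p1).
split.
- have [x0|x0] := leP (lp_norm p x) 0.
    have -> : lp_norm p x = 0 by apply/eqP; rewrite eq_le x0 lp_norm_ge0.
    rewrite mul0e /mule_ytop mule0; apply: cond_number_le0; last exact: only0.
    exact: rel_dist_normwisexx.
  (* If [F x = 0], the quotient of norms is [+oo], and [mule_ytop] makes the bound infinite. *)
  have [Fx0|Fx0] := eqVneq (lp_norm q (F x)) 0.
    by rewrite Fx0 inve0 gt0_muley ?lte_fin // /mule_ytop eqxx leey.
  have := cond_number_normwise_out dsigma eps0 sigma_eps p1 q1 r1 x0 (param_n x0) Fx0.
  move/le_trans; apply; rewrite le_eqVlt; apply/orP; left; apply/eqP.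
  congr (mule_ytop (B _ _) _); apply/funext => th; by rewrite !mulmx1.
- have [Fx0|Fx0] := eqVneq (lp_norm q (F x)) 0.
    by rewrite Fx0 inve0 gt0_muley ?lte_fin // /mule_ytop eqxx leey.
  exact: (cond_number_normwise_out dsigma eps0 sigma_eps (leey 1) q1 r1 ltr01 param_c Fx0).
- have [x0|x0] := leP (lp_norm p x) 0.
    have -> : lp_norm p x = 0 by apply/eqP; rewrite eq_le x0 lp_norm_ge0.
    rewrite mule0; apply: cond_number_le0; last exact: only0.
    exact: rel_dist_componentwisexx.
  have xN : exists z, x = 1%:M *m z by exists x; rewrite mul1mx.
  have := cond_number_componentwise_out Wup Wgate Wdown
    dsigma eps0 sigma_eps p1 r1 x0 (param_n x0) xN.
  move/le_trans; apply; rewrite le_eqVlt; apply/orP; left; apply/eqP.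
  congr (B _ _ * _)%E; apply/funext => th; by rewrite !mulmx1.
- have xN : exists z, x = diagc x *m z.
    (* The all-ones vector is the full relative perturbation, mapped by [diagc x] to [x]. *)
    exists (const_mx 1); apply/colP => i.
    by rewrite /diagc mul_diag_mx !mxE mulr1.
  rewrite -[leRHS]mule1.
  exact: (cond_number_componentwise_out Wup Wgate Wdown
    dsigma eps0 sigma_eps (leey 1) r1 ltr01 param_c xN).
Qed.
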